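(* Let $D=(E,s,t)$ be a demi-matroid on $E=\{1,\dots,n\}$ and let $f\in\mathrm{Harm}_d(n)$. Then: (i) $\lambda^{s(E)-d}\,Z_{D^\ast,f}(\lambda,x,y)=(-1)^d\,Z_{D,f}(\lambda,\;x+(\lambda-1)y,\;x-y)$; (ii) $\lambda^{-s(E)}\,Z_{\overline D,f}(\lambda,x,y)=(-1)^d\,Z_{D,f}(1/\lambda,\;x,\;x-y)$.
   Context: Let $E=\{1,\dots,n\}$, let $0\le d\le n$, and let $E_d$ be the set of $d$-element subsets of $E$. $\mathbb{R}E_d$ is the real vector space with basis $E_d$; its elements $f=\sum_{Z\in E_d}f(Z)Z$ are identified with functions $E_d\to\mathbb{R}$. The linear map $\gamma$ on $\mathbb{R}E_d$ is given by $\gamma(Z)=\sum_{Y\in E_{d-1},\,Y\subseteq Z}Y$ for $Z\in E_d$ (and $\gamma=0$ if $d=0$), and $\mathrm{Harm}_d(n)=\ker(\gamma|_{\mathbb{R}E_d})$. For $f\in\mathbb{R}E_d$ and $X\subseteq E$ put $\widetilde f(X)=\sum_{Z\in E_d,\,Z\subseteq X}f(Z)$. A (real) demi-matroid is a triple $D=(E,s,t)$ with functions $s,t:2^E\to\mathbb{R}$ such that: (D1) if $X\subseteq Y\subseteq E$ then $0\le s(X)\le s(Y)\le|Y|$ and $0\le t(X)\le t(Y)\le|Y|$; (D2) if $X\subseteq E$ then $|E-X|-s(E-X)=t(E)-t(X)$. Its dual is $D^\ast=(E,t,s)$ and its supplement is $\overline D=(E,\overline s,\overline t)$, where $\overline g(X)=g(E)-g(E-X)$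 for $g:2^E\to\mathbb{R}$; both are again demi-matroids. For $T\subseteq E$, let $D.T$ denote the contraction $D/(E-T)$ of $D$ to $T$, whose first function is $\widehat s(X)=s(X\cup(E-T))-s(E-T)$ for $X\subseteq T$. Its characteristic polynomial is $\chi(D.T;\lambda)=\sum_{X\subseteq T}(-1)^{|X|}\lambda^{\widehat s(T)-\widehat s(X)}$. The harmonic coboundary polynomial of $D$ associated to $f\in\mathrm{Harm}_d(n)$ is $$W_{D,f}(\lambda,x,y)=\sum_{T\subseteq E}\widetilde f(T)\,\chi(D.T;\lambda)\,x^{|E-T|}y^{|T|}.$$ It is known that $\widetilde f(T)=0$ when $|T|<d$ or $|T|>n-d$, and $Z_{D,f}$ denotes the polynomial in $x,y$ with $W_{D,f}(\lambda,x,y)=(xy)^dZ_{D,f}(\lambda,x,y)$, i.e. $Z_{D,f}(\lambda,x,y)=\sum_{T\subseteq E,\,d\le|T|\le n-d}\widetilde f(T)\chi(D.T;\lambda)x^{|E-T|-d}y^{|T|-d}$. Since $s$ is real-valued, $\lambda$ is read as a positive real number so that its real powers are defined. *)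

(* Defs.v *)
From mathcomp Require Import all_boot all_order all_algebra.
From mathcomp Require Import mpoly.
From mathcomp Require Import reals exp.
From mathcomp Require Import zify lra.

Set Implicit Arguments.
Unset Strict Implicit.
Unset Printing Implicit Defensive.

Import Order.TTheory GRing.Theory Num.Theory.
Local Open Scope ring_scope.

(* The ground set E = {1, ..., n} is 'I_n, and 2^E is {set 'I_n}. *)

Record demimatroid (R : realType) (n : nat) := DemiMatroid {
  dm_s : {set 'I_n} -> R;
  dm_t : {set 'I_n} -> R;
  dm_s_mono : forall X Y : {set 'I_n}, X \subset Y ->
    [/\ 0 <= dm_s X, dm_s X <= dm_s Y & dm_s Y <= #|Y|%:R];
  dm_t_mono : forall X Y : {set 'I_n}, X \subset Y ->
    [/\ 0 <= dm_t X, dm_t X <= dm_t Y & dm_t Y <= #|Y|%:R];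
  dm_dual : forall X : {set 'I_n},
    #|~: X|%:R - dm_s (~: X) = dm_t [set: 'I_n] - dm_t X }.

Definition supp_fun (R : realType) (n : nat) (g : {set 'I_n} -> R)
    (X : {set 'I_n}) : R :=
  g [set: 'I_n] - g (~: X).

Section DualAndSupplement.
Variables (R : realType) (n : nat) (D : demimatroid R n).
Implicit Types X Y : {set 'I_n}.

Lemma dm_t0 : dm_t D set0 = 0.
Proof.
have [h0 _ h1] := dm_t_mono D (subxx set0).
by apply/eqP; rewrite eq_le h0 andbT; rewrite cards0 in h1.
Qed.

Lemma dm_dual_sym X :
  #|~: X|%:R - dm_t D (~: X) = dm_s D [set: 'I_n] - dm_s D X.
Proof.
have h1 := dm_dual D (~: X); have h2 := dm_dual D set0.
rewrite setCK in h1; rewrite setC0 cardsT card_ord dm_t0 in h2.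
have cE : (#|X| + #|~: X|)%:R = n%:R :> R by rewrite cardsC card_ord.
by rewrite natrD in cE; lra.
Qed.

Definition dualdm : demimatroid R n :=
  DemiMatroid (dm_t_mono D) (dm_s_mono D) dm_dual_sym.

Lemma supp_s_mono X Y : X \subset Y ->
  [/\ 0 <= supp_fun (dm_s D) X, supp_fun (dm_s D) X <= supp_fun (dm_s D) Y
    & supp_fun (dm_s D) Y <= #|Y|%:R].
Proof.
move=> sXY; rewrite /supp_fun; split.
- by have [_ h _] := dm_s_mono D (subsetT (~: X)); lra.
- have sYX : ~: Y \subset ~: X by rewrite setCS.
  by have [_ h _] := dm_s_mono D sYX; lra.
- have := dm_dual_sym (~: Y); rewrite setCK => <-.
  by have [h _ _] := dm_t_mono D (subxx Y); lra.
Qed.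

Lemma supp_t_mono X Y : X \subset Y ->
  [/\ 0 <= supp_fun (dm_t D) X, supp_fun (dm_t D) X <= supp_fun (dm_t D) Y
    & supp_fun (dm_t D) Y <= #|Y|%:R].
Proof.
move=> sXY; rewrite /supp_fun; split.
- by have [_ h _] := dm_t_mono D (subsetT (~: X)); lra.
- have sYX : ~: Y \subset ~: X by rewrite setCS.
  by have [_ h _] := dm_t_mono D sYX; lra.
- have := dm_dual D (~: Y); rewrite setCK => <-.
  by have [h _ _] := dm_s_mono D (subxx Y); lra.
Qed.

Lemma supp_dual X :
  #|~: X|%:R - supp_fun (dm_s D) (~: X) =
  supp_fun (dm_t D) [set: 'I_n] - supp_fun (dm_t D) X.
Proof.
rewrite /supp_fun setCK setCT dm_t0.
by have := dm_dual_sym X; lra.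
Qed.

Definition suppdm : demimatroid R n :=
  DemiMatroid supp_s_mono supp_t_mono supp_dual.
End DualAndSupplement.

Definition ksub (n d : nat) := {Z : {set 'I_n} | #|Z| == d}.

(* The codomain R^o makes {ffun _ -> R^o} the R-vector space with basis E_d. *)
Definition RE (R : realType) (n d : nat) := {ffun ksub n d -> R^o}.

Definition basisRE (R : realType) (n d : nat) (Z : ksub n d) : RE R n d :=
  [ffun Z' => (Z' == Z)%:R].

(* The test d == 0 is needed because 0.-1 = 0. *)
Definition gamma (R : realType) (n d : nat) (f : RE R n d) : RE R n d.-1 :=
  if d == 0%N then 0 else
  \sum_(Z : ksub n d)
    f Z *: \sum_(Y : ksub n d.-1 | val Y \subset val Z) basisRE R Y.

Definition Harm (R : realType) (n d : nat) : {pred RE R n d} :=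
  [pred f | gamma f == 0].
Arguments Harm : clear implicits.

Definition ftilde (R : realType) (n d : nat) (f : RE R n d)
    (X : {set 'I_n}) : R :=
  \sum_(Z : ksub n d | val Z \subset X) f Z.

(* First function of D / A, to be evaluated at subsets of the complement of A. *)
Definition contract (R : realType) (n : nat) (s : {set 'I_n} -> R)
    (A X : {set 'I_n}) : R :=
  s (X :|: A) - s A.

(* Characteristic polynomial of a demi-matroid with ground set T and first
   function g, as a function of l > 0 (the exponents are real). *)
Definition charfun (R : realType) (n : nat) (T : {set 'I_n})
    (g : {set 'I_n} -> R) (l : R) : R :=
  \sum_(X : {set 'I_n} | X \subset T) (-1) ^+ #|X| * l `^ (g T - g X).

Definition chi (R : realType) (n : nat) (D : demimatroid R n)
    (T : {set 'I_n}) (l : R) : R :=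
  charfun T (contract (dm_s D) (~: T)) l.

(* For fixed l, W and Z are polynomials in the two variables x and y. *)
Definition px (R : realType) : {mpoly R[2]} := 'X_ord0.
Definition py (R : realType) : {mpoly R[2]} := 'X_ord_max.

Definition Wpoly (R : realType) (n d : nat) (D : demimatroid R n)
    (f : RE R n d) (l : R) : {mpoly R[2]} :=
  \sum_(T : {set 'I_n})
    (ftilde f T * chi D T l) *: (px R ^+ #|~: T| * py R ^+ #|T|).

(* In the range of the sum the truncated subtractions are exact. *)
Definition Zpoly (R : realType) (n d : nat) (D : demimatroid R n)
    (f : RE R n d) (l : R) : {mpoly R[2]} :=
  \sum_(T : {set 'I_n} | (d <= #|T| <= n - d)%N)
    (ftilde f T * chi D T l) *:
      (px R ^+ (#|~: T| - d) * py R ^+ (#|T| - d)).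

(* p(u, v) *)
Definition subst2 (R : realType) (p u v : {mpoly R[2]}) : {mpoly R[2]} :=
  p \mPo [tuple u; v].

Section Sanity.
Variables (R : realType) (n d : nat).

Lemma gamma_is_linear : linear (@gamma R n d).
Proof.
move=> a f g; rewrite /gamma; case: eqP => _; first by rewrite scaler0 addr0.
rewrite scaler_sumr -big_split; apply: eq_bigr => Z _ /=.
by rewrite !ffunE scalerDl scalerA.
Qed.

Lemma gamma_basis (Z : ksub n d) : (0 < d)%N ->
  gamma (basisRE R Z) = \sum_(Y : ksub n d.-1 | val Y \subset val Z) basisRE R Y.
Proof.
move=> d0; rewrite /gamma eqn0Ngt d0 /= (bigD1 Z) //= ffunE eqxx scale1r.
rewrite [X in _ + X]big1 ?addr0 // => Z' nZ.
by rewrite ffunE (negbTE nZ) scale0r.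
Qed.

Lemma subst2_x (u v : {mpoly R[2]}) : subst2 (px R) u v = u.
Proof. by rewrite /subst2 comp_mpolyXU. Qed.

Lemma subst2_y (u v : {mpoly R[2]}) : subst2 (py R) u v = v.
Proof. by rewrite /subst2 comp_mpolyXU. Qed.

Lemma gammaE (f : RE R n d) (Y : ksub n d.-1) : (0 < d)%N ->
  gamma f Y = \sum_(Z : ksub n d | val Y \subset val Z) f Z.
Proof.
move=> d0; rewrite /gamma eqn0Ngt d0 /= sum_ffunE [RHS]big_mkcond /=.
apply: eq_bigr => Z _; rewrite ffunE sum_ffunE.
case: ifPn => sYZ.
  rewrite (bigD1 Y) //= ffunE eqxx [X in _ + X]big1 ?addr0 => [|Y' /andP[_ nY]].
    exact: mulr1.
  by rewrite ffunE eq_sym (negbTE nY).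
rewrite big1 ?scaler0 // => Y' sY'; rewrite ffunE; case: eqP => // eY.
by rewrite eY sY' in sYZ.
Qed.

Variables (f : RE R n d) (hf : f \in Harm R n d).

Lemma harm_sup0 (A : {set 'I_n}) : (#|A| < d)%N ->
  \sum_(Z : ksub n d | A \subset val Z) f Z = 0.
Proof.
move: {2}(d - #|A|)%N (erefl (d - #|A|)%N) => k.
elim: k A => [|k IH] A ek ltAd; first by move: ek; lia.
case: (posnP k) => [k0|k0].
  have hA : #|A| == d.-1 by apply/eqP; lia.
  have d0 : (0 < d)%N by lia.
  have := gammaE f (exist _ A hA : ksub n d.-1) d0.
  by move/eqP: hf => ->; rewrite ffunE.
have key : \sum_(a in ~: A) \sum_(Z : ksub n d | (a |: A) \subset val Z) f Z
    = (\sum_(Z : ksub n d | A \subset val Z) f Z) *+ k.+1.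
  rewrite (exchange_big_dep (fun Z : ksub n d => A \subset val Z)) /=; last first.
    by move=> a Z _; rewrite subUset => /andP[].
  rewrite -sumrMnl; apply: eq_bigr => Z sAZ.
  rewrite (eq_bigl (mem (val Z :\: A))); last first.
    by move=> a; rewrite !inE subUset sub1set sAZ andbT.
  rewrite sumr_const cardsD (setIidPr sAZ) (eqP (valP Z)).
  by rewrite ek.
rewrite big1 in key; last first.
  move=> a; rewrite inE => aA.
  have cA : #|a |: A| = #|A|.+1 by rewrite cardsU1 aA.
  by apply: IH; rewrite cA; [rewrite subnS ek | rewrite -subn_gt0 subnS ek].
by apply/eqP; move/esym/eqP: key; rewrite mulrn_eq0.
Qed.

Lemma harm_sep0 (A B : {set 'I_n}) : (#|A| + #|B| < d)%N ->
  \sum_(Z : ksub n d | (A \subset val Z) && (B \subset ~: val Z)) f Z = 0.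
Proof.
move: {2}#|B| (erefl #|B|) => k.
elim: k A B => [|k IH] A B eB lt.
  move/eqP: eB; rewrite cards_eq0 => /eqP ->.
  rewrite (eq_bigl (fun Z : ksub n d => A \subset val Z)).
    by apply: harm_sup0; lia.
  by move=> Z; rewrite sub0set andbT.
have /card_gt0P[b bB] : (0 < #|B|)%N by rewrite eB.
have eB' : #|B :\ b| = k by move: eB; rewrite (cardsD1 b) bB => -[].
have := IH A (B :\ b) eB' ltac:(lia).
rewrite (bigID (fun Z : ksub n d => b \in val Z)) /=.
rewrite (eq_bigl (fun Z : ksub n d =>
  (b |: A \subset val Z) && (B :\ b \subset ~: val Z))); last first.
  by move=> Z; rewrite subUset sub1set; case: (b \in _); rewrite ?andbT ?andbF.
rewrite IH //; last first.
  rewrite eB' cardsU1; rewrite eB addnS in lt; apply: leq_ltn_trans lt.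
  by rewrite -addnA -add1n leq_add2r; case: (b \in A).
rewrite add0r => h; apply: (etrans _ h); apply: eq_bigl => Z.
by rewrite -{1}(setD1K bB) subUset sub1set inE -andbA [(_ \notin _) && _]andbC.
Qed.

Lemma harm_ftilde0 (T : {set 'I_n}) :
  ((#|T| < d) || (n - d < #|T|))%N -> ftilde f T = 0.
Proof.
case/orP => hT.
  rewrite /ftilde big_pred0 // => Z; apply/negbTE/negP => /subset_leq_card.
  by rewrite (eqP (valP Z)) leqNgt hT.
have cT : (#|T| + #|~: T|)%N = n by rewrite cardsC card_ord.
rewrite -[RHS](@harm_sep0 set0 (~: T)); last by rewrite cards0; lia.
by apply: eq_bigl => Z; rewrite sub0set setCS.
Qed.

Lemma WpolyE (D : demimatroid R n) (l : R) : (d <= n)%N ->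
  Wpoly D f l = (px R * py R) ^+ d * Zpoly D f l.
Proof.
move=> dn; rewrite /Wpoly /Zpoly.
rewrite (bigID (fun T : {set 'I_n} => (d <= #|T| <= n - d)%N)) /=.
rewrite [X in _ + X]big1 ?addr0 => [|T hT].
  rewrite mulr_sumr; apply: eq_bigr => T /andP[h1 h2].
  rewrite -scalerAr exprMn mulrACA -!exprD.
  have cT : (#|T| + #|~: T|)%N = n by rewrite cardsC card_ord.
  have h3 : (d <= #|~: T|)%N.
    rewrite -(leq_add2l #|T|) cT; apply: leq_trans (leq_add h2 (leqnn d)) _.
    by rewrite subnK.
  by rewrite !subnKC.
rewrite harm_ftilde0 ?mul0r ?scale0r //.
by move: hT; rewrite negb_and -!ltnNge.
Qed.
End Sanity.

(* Main.v *)
Require Import Defs.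
From mathcomp Require Import all_boot all_order all_algebra.
From mathcomp Require Import mpoly.
From mathcomp Require Import reals exp.
From mathcomp Require Import zify ring.

Import Order.TTheory GRing.Theory Num.Theory.
Local Open Scope ring_scope.

(** Write s and t for the two functions of D, ~B for the complement of B and
    F(B) = l^(s(E) - s(~B)).  The point is that Z_{D,f} has a second expansion,
    in which the characteristic polynomials have been replaced by single powers
    of l:

      Z_{D,f}(x, y)
        = \sum_B ftilde f B * F(B) * y^(|B| - d) * (x - y)^(|~B| - d),

    the sum being over B with d <= |B| <= n - d (lemma [ZpolyE_subsets]).
    Once this is known, both identities hold term by term.

    To get this expansion, reindex the characteristic polynomial by complements
    inside T: chi(D.T) is the alternating sum of F over the subsets of T
    ([chiE]), that is, the Moebius inverse of F.  Exchanging the sums over T and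
    over B, it remains to evaluate, for each B, the sum of
    ftilde f T * u^|T - B| * v^|~T| over the T that contain B.  For d = 0 and
    f = 1 this is the binomial theorem and gives (u + v)^|~B|; for harmonic f
    it is ftilde f B * v^d * (u + v)^(|~B| - d) ([harm_sum_supsets]).

    Harmonicity enters through [harm_sum_meet], which evaluates the sum over
    the d-subsets Z of f(Z) u^|Z & B| w^|Z - B|.  Writing u = (u - w) + w and
    expanding turns it into a sum over subsets S of B of the sums of f over the
    Z that contain S.  These vanish for |S| < d because f is harmonic and for
    |S| > d trivially, so only the d-subsets of B contribute.  At u = 0, w = 1
    it gives the antisymmetry ftilde f (~B) = (-1)^d ftilde f B, which is the
    source of the sign in the theorem.

    Substitute now (u, v) for (x, y) in the expansion and replace B by ~B: up
    to the sign, the general term becomes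
    ftilde f B * l^(s(E) - s(B)) * (u - v)^(|B| - d) * v^(|~B| - d)
    ([subst2_ZpolyE]).  For duality, u - v = l y; the powers of l then
    combine to l^(s(E) - d) * l^(|B| - s(B)), which is what the dual requires
    because t(E) - t(~B) = |B| - s(B).  For the supplement, u - v = y,
    and passing from l to 1/l turns s(E) - s(B) into
    (sbar(E) - sbar(~B)) - s(E), where sbar is the first function of the
    supplement. *)

(** * Binomial sums over subsets *)

Lemma sum_subsets_exp {T : finType} {A : comNzRingType} (B : {set T})
    (a b : A) :
  \sum_(S : {set T} | S \subset B) a ^+ #|S| * b ^+ (#|B| - #|S|)
    = (a + b) ^+ #|B|.
Proof.
rewrite addrC exprDn.
rewrite (partition_big (fun S : {set T} => inord #|S| : 'I_#|B|.+1) xpredT) //=.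
apply: eq_bigr => i _.
transitivity (\sum_(S in [set S : {set T} | S \subset B & #|S| == i])
                a ^+ i * b ^+ (#|B| - i)).
  apply: eq_big => [S|S /andP[sSB /eqP eS]].
    rewrite inE; case sSB: (S \subset B) => //=.
    by rewrite -val_eqE /= inordK // ltnS subset_leq_card.
  by rewrite -eS inordK // ltnS subset_leq_card.
by rewrite sumr_const cards_draws mulrC.
Qed.

(** The complement of S runs over the subsets of the complement of [B :|: Y],
    while [Y :\: B] lies in [S :\: B] for every S in the sum. *)
Lemma sum_supsets_exp {T : finType} {A : comNzRingType} (B Y : {set T})
    (a b : A) :
  \sum_(S : {set T} | (B \subset S) && (Y \subset S))
      a ^+ #|S :\: B| * b ^+ #|~: S|
    = a ^+ #|Y :\: B| * (a + b) ^+ #|~: (B :|: Y)|.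
Proof.
rewrite addrC -sum_subsets_exp mulr_sumr [RHS](reindex_inj (@setC_inj _)) /=.
apply: eq_big => [S|S]; first by rewrite setCS subUset.
move=> /andP[sBS sYS]; rewrite mulrCA [LHS]mulrC -exprD; congr (_ * _ ^+ _).
have sBYS : B :|: Y \subset S by rewrite subUset sBS.
have -> : #|~: (B :|: Y)| = (#|S :\: (B :|: Y)| + #|~: S|)%N.
  rewrite -(cardsID S (~: (B :|: Y))) setIC -setDE.
  congr (_ + #|pred_of_set _|)%N.
  by rewrite setDE (setIidPr _) // setCS.
rewrite addnK -(cardsID Y (S :\: B)) setDDl; congr (#|pred_of_set _| + _)%N.
by rewrite setIC setIDA (setIidPl sYS).
Qed.

(** * Sums of harmonic functions *)

(** Expanding [u ^+ #|val Z :&: B|] as a power of [(u - w) + w] gives a term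
    for each subset S of [val Z :&: B]; summed over Z first, harmonicity kills
    the terms with [#|S| < d], and only [S = val Z] is left. *)
Lemma harm_sum_meet {R : realType} {n d : nat} (f : RE R n d)
    (hf : f \in Harm R n d) {A : comAlgType R} (B : {set 'I_n}) (u w : A) :
  \sum_(Z : ksub n d) f Z *: (u ^+ #|val Z :&: B| * w ^+ #|val Z :\: B|)
    = ftilde f B *: (u - w) ^+ d.
Proof.
transitivity (\sum_(S : {set 'I_n} | S \subset B)
    (\sum_(Z : ksub n d | S \subset val Z) f Z) *:
      ((u - w) ^+ #|S| * w ^+ (d - #|S|))).
  under [RHS]eq_bigr do rewrite scaler_suml.
  rewrite (exchange_big_dep xpredT) //=; apply: eq_bigr => Z _.
  rewrite -scaler_sumr; congr (_ *: _).
  rewrite -{1}(subrK w u) -sum_subsets_exp mulr_suml.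
  apply: eq_big => [S|S]; rewrite subsetI; first by rewrite andbC.
  move=> /andP[sSZ sSB]; rewrite -mulrA -exprD; congr (_ * _ ^+ _).
  have := cardsID B (val Z); rewrite (eqP (valP Z)).
  have : S \subset val Z :&: B by rewrite subsetI sSZ.
  by move/subset_leq_card; move: #|_| #|_| #|_| => i j k; lia.
rewrite (bigID (fun S : {set 'I_n} => #|S| == d)) /= [X in _ + X]big1 ?addr0.
  transitivity (\sum_(S : {set 'I_n} | (S \subset B) && (#|S| == d))
      \sum_(Z : ksub n d | S \subset val Z) f Z *: (u - w) ^+ d).
    by apply: eq_bigr => S /andP[_ /eqP ->]; rewrite subnn mulr1 scaler_suml.
  rewrite /ftilde scaler_suml [RHS]big_mkcond /= (exchange_big_dep xpredT) //=.
  apply: eq_bigr => Z _.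
  have eqZ (S : {set 'I_n}) : #|S| == d -> S \subset val Z -> S = val Z.
    move=> /eqP cS sSZ; apply/eqP.
    by rewrite eqEcard sSZ cS (eqP (valP Z)) leqnn.
  case: ifPn => sZB.
    rewrite (big_pred1 (val Z)) // => S.
    apply/andP/eqP => [[/andP[_ cS] sSZ]|->]; first exact: eqZ.
    by rewrite sZB subxx (valP Z).
  rewrite big_pred0 // => S; apply/negbTE/negP => /andP[/andP[sSB cS] sSZ].
  by case/negP: sZB; rewrite -(eqZ S).
move=> S /andP[_ nSd]; case: (ltngtP #|S| d) => [ltSd|ltdS|eSd].
- by rewrite (harm_sup0 hf ltSd) scale0r.
- rewrite big_pred0 ?scale0r // => Z; apply/negbTE/negP => /subset_leq_card.
  by rewrite (eqP (valP Z)) leqNgt ltdS.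
- by rewrite eSd eqxx in nSd.
Qed.

(** At [u = 0], [w = 1] the sum of [harm_sum_meet] only keeps the Z that are
    disjoint from [B]. *)
Lemma harm_ftildeC {R : realType} {n d : nat} (f : RE R n d)
    (hf : f \in Harm R n d) (B : {set 'I_n}) :
  ftilde f (~: B) = (-1) ^+ d * ftilde f B.
Proof.
have := harm_sum_meet f hf B (0 : R^o) 1; rewrite sub0r => h.
rewrite mulrC; apply: (etrans _ h).
rewrite /ftilde big_mkcond; apply: eq_bigr => Z _.
rewrite expr1n mulr1 expr0n cards_eq0 setI_eq0 disjoints_subset.
by case: ifP => _; rewrite ?scaler0 // /GRing.scale /= mulr1.
Qed.

(** The harmonic form of the binomial theorem.  For a fixed Z, the sum over the
    T containing [B] and Z is [u ^+ #|Z :\: B|] times a power of [u + v]; then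
    [harm_sum_meet] applies to the complement of [B] with [w = u + v], and
    [u - w = - v] gives the factor [v ^+ d]. *)
Lemma harm_sum_supsets {R : realType} {n d : nat} (f : RE R n d)
    (hf : f \in Harm R n d) {A : comAlgType R} (B : {set 'I_n}) (u v : A) :
  \sum_(T : {set 'I_n} | B \subset T)
      ftilde f T *: (u ^+ #|T :\: B| * v ^+ #|~: T|)
    = ftilde f B *: (v ^+ d * (u + v) ^+ (#|~: B| - d)).
Proof.
have cB : (#|B| + #|~: B| = n)%N by rewrite cardsC card_ord.
(* If #|~: B| < d, the exponent on the right is a truncated difference, but
   both sides vanish: ftilde f is zero on B and its supersets. *)
case: (ltnP #|~: B| d) => [ltBd|ledB].
  rewrite (harm_ftilde0 hf) ?scale0r; last by lia.
  apply: big1 => T sBT; rewrite (harm_ftilde0 hf) ?scale0r //.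
  by have := subset_leq_card sBT; lia.
have sE : (-1) ^+ d * ftilde f (~: B) = ftilde f B.
  by rewrite -(harm_ftildeC f hf) setCK.
have -> : ftilde f B *: (v ^+ d * (u + v) ^+ (#|~: B| - d)) =
          (ftilde f (~: B) *: (u - (u + v)) ^+ d) * (u + v) ^+ (#|~: B| - d).
  rewrite opprD addrA subrr sub0r -scaleN1r exprZn scalerA -scalerAl.
  by rewrite [ftilde f (~: B) * _]mulrC sE.
rewrite -(harm_sum_meet f hf) mulr_suml.
under eq_bigr do rewrite scaler_suml.
rewrite (exchange_big_dep xpredT) //=; apply: eq_bigr => Z _.
rewrite -scaler_sumr -scalerAl; congr (_ *: _).
have cZ := cardsID (~: B) (val Z); rewrite (eqP (valP Z)) in cZ.
rewrite -mulrA -exprD.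
have -> : (#|val Z :\: ~: B| + (#|~: B| - d) = #|~: (B :|: val Z)|)%N.
  by rewrite setCU -setDE [RHS]cardsD [~: B :&: _]setIC; lia.
by rewrite -setDE; exact: sum_supsets_exp.
Qed.

(** * The expansions of W and Z over subsets *)

(** The exponent in the term of X is a difference of values of the first
    function at E and at the complement of [B = T :\: X], so that X is best
    replaced by B: the power of [l] then depends on B but not on T. *)
Lemma chiE {R : realType} {n : nat} (D : demimatroid R n) (T : {set 'I_n})
    (l : R) :
  chi D T l = \sum_(B : {set 'I_n} | B \subset T)
    (-1) ^+ #|T :\: B| * l `^ (dm_s D [set: 'I_n] - dm_s D (~: B)).
Proof.
rewrite /chi /charfun (reindex_onto (setD T) (setD T)) /=; last first.
  by move=> X /setIidPr; rewrite setDDr setDv set0U.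
apply: eq_big => [B|B].
  rewrite subsetDl /= setDDr setDv set0U.
  by apply/eqP/setIidPr.
move=> /andP[_ /eqP eB]; have sBT : B \subset T by rewrite -eB subsetDl.
congr (_ * _ `^ _); rewrite /contract setUCr opprB addrA subrK.
congr (_ - dm_s D _); rewrite setDE setUIl setUCr setTI.
by rewrite -setCI (setIidPl sBT).
Qed.

(** [chiE] inside W, with the sign absorbed into the powers of [- y]; the inner
    sums over the T that contain [B] are then those of [harm_sum_supsets]. *)
Lemma WpolyE_subsets {R : realType} {n d : nat} (D : demimatroid R n)
    (f : RE R n d) (hf : f \in Harm R n d) (l : R) :
  Wpoly D f l = \sum_(B : {set 'I_n})
    (ftilde f B * l `^ (dm_s D [set: 'I_n] - dm_s D (~: B))) *:
      (py R ^+ #|B| * px R ^+ d * (px R - py R) ^+ (#|~: B| - d)).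
Proof.
rewrite /Wpoly.
transitivity (\sum_(B : {set 'I_n}) \sum_(T : {set 'I_n} | B \subset T)
    l `^ (dm_s D [set: 'I_n] - dm_s D (~: B)) *: (py R ^+ #|B| *
      (ftilde f T *: ((- py R) ^+ #|T :\: B| * px R ^+ #|~: T|)))).
  rewrite (exchange_big_dep xpredT) //=; apply: eq_bigr => T _.
  rewrite chiE mulr_sumr scaler_suml; apply: eq_bigr => B sBT.
  have -> : #|T| = (#|T :\: B| + #|B|)%N.
    by rewrite -(cardsID B T) (setIidPr sBT) addnC.
  rewrite exprD -(scaleN1r (py R)) exprZn -!scalerAr -!scalerAl -?scalerAr.
  rewrite !scalerA.
  by congr (_ *: _); ring.
apply: eq_bigr => B _.
rewrite -scaler_sumr -mulr_sumr (harm_sum_supsets f hf) -scalerAr scalerA.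
by rewrite [_ * ftilde f B]mulrC [- _ + _]addrC mulrA.
Qed.

(** The factor [(x y) ^ d] is cancelled from the expansion of W; the sets of
    size outside the range drop out because [ftilde f] vanishes on them. *)
Lemma ZpolyE_subsets {R : realType} {n d : nat} (hd : (d <= n)%N)
    (D : demimatroid R n)
    (f : RE R n d) (hf : f \in Harm R n d) (l : R) :
  Zpoly D f l = \sum_(B : {set 'I_n} | (d <= #|B| <= n - d)%N)
    (ftilde f B * l `^ (dm_s D [set: 'I_n] - dm_s D (~: B))) *:
      (py R ^+ (#|B| - d) * (px R - py R) ^+ (#|~: B| - d)).
Proof.
apply: (@mulfI _ ((px R * py R) ^+ d)).
  by rewrite expf_neq0 // mulf_neq0 // -msupp_eq0 msuppX.
rewrite -WpolyE // (WpolyE_subsets D f hf).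
rewrite (bigID (fun T : {set 'I_n} => (d <= #|T| <= n - d)%N)) /=.
rewrite [X in _ + X]big1 ?addr0 => [|B hB]; last first.
  rewrite harm_ftilde0 ?mul0r ?scale0r //.
  by rewrite negb_and -!ltnNge in hB.
rewrite mulr_sumr; apply: eq_bigr => B /andP[h1 _].
rewrite -scalerAr exprMn mulrA -{1}(subnKC h1) exprD.
by congr (_ *: (_ * _)); ring.
Qed.

(** Replacing [B] by its complement exchanges the two exponents and, by
    [harm_ftildeC], produces the sign that cancels [(-1) ^+ d].  The terms now
    carry the same [ftilde f B] as those of [ZpolyE_subsets]. *)
Lemma subst2_ZpolyE {R : realType} {n d : nat} (hd : (d <= n)%N)
    (D : demimatroid R n) (f : RE R n d) (hf : f \in Harm R n d) (l : R)
    (u v : {mpoly R[2]}) :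
  (-1) ^+ d *: subst2 (Zpoly D f l) u v
    = \sum_(B : {set 'I_n} | (d <= #|B| <= n - d)%N)
        (ftilde f B * l `^ (dm_s D [set: 'I_n] - dm_s D B)) *:
          ((u - v) ^+ (#|B| - d) * v ^+ (#|~: B| - d)).
Proof.
rewrite (ZpolyE_subsets hd D f hf) (reindex_inj (@setC_inj _)) /=.
rewrite /subst2 [_ \mPo _]raddf_sum scaler_sumr /=; apply: eq_big => [B|B _].
  have := cardsC B; rewrite card_ord; move: #|B| #|~: B| => b c bc; lia.
rewrite setCK (harm_ftildeC f hf) comp_mpolyZ rmorphM !rmorphXn rmorphB /=.
rewrite -!/(subst2 _ _ _) subst2_x subst2_y scalerA !mulrA.
by rewrite -expr2 sqrr_sign mul1r [v ^+ _ * _]mulrC.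
Qed.

(** * The two identities *)

Theorem theorem4p3 (R : realType) (n d : nat) (hd : (d <= n)%N)
    (D : demimatroid R n) (f : RE R n d) (hf : f \in Harm R n d)
    (l : R) (hl : 0 < l) :
  l `^ (dm_s D [set: 'I_n] - d%:R) *: Zpoly (dualdm D) f l
    = (-1) ^+ d *: subst2 (Zpoly D f l)
                     (px R + (l - 1) *: py R) (px R - py R)
  /\
  l `^ (- dm_s D [set: 'I_n]) *: Zpoly (suppdm D) f l
    = (-1) ^+ d *: subst2 (Zpoly D f (1 / l)) (px R) (px R - py R).
Proof.
have powRDl (a b : R) : l `^ a * l `^ b = l `^ (a + b).
  by rewrite powRD // (gt_eqF hl) implybT.
rewrite !(subst2_ZpolyE hd D f hf) !(ZpolyE_subsets hd _ f hf) !scaler_sumr.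
split; apply: eq_bigr => B /andP[dB _]; rewrite scalerA.
  have -> : px R + (l - 1) *: py R - (px R - py R) = l *: py R.
    by rewrite scalerBl scale1r; ring.
  rewrite exprZn -scalerAl scalerA; congr (_ *: _).
  rewrite mulrCA -mulrA; congr (_ * _).
  rewrite -powR_mulrn ?ltW // !powRDl natrB //.
  have := dm_dual D (~: B); rewrite setCK /= => <-.
  by congr (_ `^ _); ring.
have -> : px R - (px R - py R) = py R by ring.
congr (_ *: _); rewrite mulrCA; congr (_ * _).
have s0 : dm_s D set0 = 0 := dm_t0 (dualdm D).
rewrite powRDl mul1r -powR_inv1 ?ltW // -powRrM /= /supp_fun setCT setCK s0.
by congr (_ `^ _); ring.
Qed.
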